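(* The universal Urysohn metric space $\mathbb{U}$ cannot be embedded, as a uniform subspace, into a superreflexive Banach space. That is, there is no superreflexive Banach space $E$ together with an injective map $f\colon\mathbb{U}\to E$ such that $f$ is uniformly continuous and the inverse map $f^{-1}\colon f(\mathbb{U})\to\mathbb{U}$ is uniformly continuous.
   Context: The universal Urysohn metric space $\mathbb{U}$ is the complete separable metric space, unique up to isometry, which contains an isometric copy of every separable metric space and is ultrahomogeneous, that is, every isometry between two finite subspaces of $\mathbb{U}$ extends to a global self-isometry (a distance-preserving bijection) of $\mathbb{U}$. A Banach space is superreflexive if every Banach space ultrapower of it is a reflexive Banach space (equivalently, if it admits an equivalent uniformly convex norm). Given an ultrafilter $\xi$ on a set $A$, the Banach space ultrapower of $E$ along $\xi$ is the quotient of the space of all bounded families $(y_\alpha)_{\alpha\in A}$ in $E$, equipped with the seminorm $\lim_{\alpha\to\xi}\|y_\alpha\|$, by the subspace of families of seminorm zero. *)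

(* Defs.v *)
From HB Require Import structures.
From mathcomp Require Import all_boot all_order all_algebra.
From mathcomp Require Import generic_quotient ring_quotient.
From mathcomp Require Import all_classical all_reals all_analysis.

Set Implicit Arguments.
Unset Strict Implicit.
Unset Printing Implicit Defensive.

Import Order.TTheory GRing.Theory Num.Theory.
Import numFieldNormedType.Exports.

Local Open Scope classical_set_scope.
Local Open Scope ring_scope.

Section Urysohn.
Context {R : realType}.

Definition isometric (X Y : metricType R) (f : X -> Y) : Prop :=
  forall x y, mdist (f x) (f y) = mdist x y.

(* The library's [completeType] and [cvg] require pointed types, hence the
   explicit limit. *)
Definition complete_space (X : uniformType) : Prop :=
  forall F : set_system X, ProperFilter F -> cauchy F -> exists x : X, F --> x.

Definition separable (X : topologicalType) : Prop :=
  exists2 D : set X, countable D & dense D.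

Definition ultrahomogeneous (X : metricType R) : Prop :=
  forall (A B : set X) (f : X -> X), finite_set A -> finite_set B ->
    set_bij A B f ->
    {in A &, forall x y, mdist (f x) (f y) = mdist x y} ->
  exists g : X -> X, [/\ bijective g, isometric g & {in A, f =1 g}].

Definition urysohn_space (U : metricType R) : Prop :=
  [/\ complete_space U,
      separable U,
      forall X : metricType R, separable X ->
        exists f : X -> U, isometric f
    & ultrahomogeneous U].

End Urysohn.

(* [g] is the inverse map f(X) -> X, with f(X) carrying the uniformity induced
   by [Y]. *)
Definition uniform_embedding (X Y : uniformType) (f : X -> Y) : Prop :=
  [/\ injective f,
      unif_continuous f
    & exists2 g : set_type (range f) -> X,
        (forall y, f (g y) = \val y) & unif_continuous g].

Section Dual.
Context {R : realType} (F : normedModType R).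

Definition cont_linear_form : {pred F -> R^o} :=
  mem [set f : F -> R^o | linear f /\ continuous f].

Record dual := Dual {
  dual_fun :> F -> R^o ;
  dual_funP : dual_fun \in cont_linear_form }.

HB.instance Definition _ := [isSub for dual_fun].
HB.instance Definition _ := [Choice of dual by <:].

Lemma cont_linear_form_submod_closed : submod_closed cont_linear_form.
Proof.
split=> [|a f g].
  rewrite inE; split=> [b x y|x].
    by rewrite /GRing.zero/= scaler0 addr0.
  exact: cvg_cst.
rewrite !inE => -[lf cf] [lg cg]; split=> [b x y|x].
  rewrite addrfctE scalrfctE lf lg !scalerDr !scalerA.
  by rewrite addrACA (mulrC a b).
by apply: cvgD; [apply: cvgZl_tmp; exact: cf|exact: cg].
Qed.

HB.instance Definition _ := GRing.isSubmodClosed.Build R (F -> R^o)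
  cont_linear_form cont_linear_form_submod_closed.
HB.instance Definition _ := [SubChoice_isSubLmodule of dual by <:].

Lemma dual_linear (f : dual) : linear f.
Proof. by have := dual_funP f; rewrite inE => -[]. Qed.

Lemma dual_continuous (f : dual) : continuous f.
Proof. by have := dual_funP f; rewrite inE => -[]. Qed.

Lemma dualZ (f : dual) a x : f (a *: x) = a *: f x.
Proof.
have f0 : f 0 = 0.
  have /eqP := dual_linear f 1 0 0; rewrite !scale1r addr0.
  by rewrite -subr_eq0 opprD addrA subrr sub0r oppr_eq0 => /eqP.
by have := dual_linear f a x 0; rewrite !addr0 f0 addr0.
Qed.

Lemma dual_bounded (f : dual) : exists2 M, 0 < M & forall x, `|f x| <= M * `|x|.
Proof.
pose g : {linear F -> R^o} := HB.pack (dual_fun f)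
  (GRing.isLinear.Build R F R^o *:%R (dual_fun f) (dual_linear f)).
have /(linear_bounded_continuous g)/linear_boundedP : continuous g.
  exact: dual_continuous.
by move=> /pinfty_ex_gt0[M M0 fM]; exists M.
Qed.

Definition dual_norm (f : dual) : R :=
  sup [set `|f x| | x in [set x : F | `|x| <= 1]].

Lemma dual_norm_has_sup (f : dual) :
  has_sup [set `|f x| | x in [set x : F | `|x| <= 1]].
Proof.
split; first by exists `|f 0|, 0 => //=; rewrite normr0.
have [M M0 fM] := dual_bounded f.
exists M => _ [x /= x1 <-]; rewrite (le_trans (fM x))//.
by rewrite -[leRHS]mulr1 ler_wpM2l// ltW.
Qed.

Lemma dual_norm_ub (f : dual) x : `|x| <= 1 -> `|f x| <= dual_norm f.
Proof.
by move=> x1; apply: ub_le_sup; [exact: (dual_norm_has_sup f).2|exists x].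
Qed.

Lemma dual_norm_le (f : dual) M :
  (forall x, `|x| <= 1 -> `|f x| <= M) -> dual_norm f <= M.
Proof.
move=> fM; apply: ge_sup; first exact: (dual_norm_has_sup f).1.
by move=> _ [x /= x1 <-]; exact: fM.
Qed.

Lemma le_dual_norm (f : dual) x : `|f x| <= dual_norm f * `|x|.
Proof.
have [->|x0] := eqVneq x 0.
  by have := dualZ f 0 0; rewrite !scale0r => ->; rewrite !normr0 mulr0.
rewrite -ler_pdivrMr ?normr_gt0//.
have -> : `|f x| / `|x| = `|f (`|x|^-1 *: x)|.
  by rewrite dualZ normrZ normfV normr_id mulrC.
apply: dual_norm_ub.
by rewrite normrZ normfV normr_id mulVf ?normr_eq0.
Qed.

Lemma dual_norm_ge0 (f : dual) : 0 <= dual_norm f.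
Proof.
by rewrite (le_trans (normr_ge0 (f 0)))// dual_norm_ub// normr0.
Qed.

Let dual_normD (f g : dual) : dual_norm (f + g) <= dual_norm f + dual_norm g.
Proof.
apply: dual_norm_le => x x1.
have -> : (f + g : dual) x = f x + g x by [].
by rewrite (le_trans (ler_normD _ _))// lerD// dual_norm_ub.
Qed.

Let dual_normZ_le (a : R) (f : dual) : dual_norm (a *: f) <= `|a| * dual_norm f.
Proof.
apply: dual_norm_le => x x1.
have -> : (a *: f : dual) x = a *: f x by [].
by rewrite normrZ ler_wpM2l// dual_norm_ub.
Qed.

Let dual_normZ (a : R) (f : dual) : dual_norm (a *: f) = `|a| * dual_norm f.
Proof.
apply/eqP; rewrite eq_le dual_normZ_le/=.
have [->|a0] := eqVneq a 0; first by rewrite normr0 mul0r dual_norm_ge0.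
rewrite -ler_pdivlMl ?normr_gt0// -normfV.
by rewrite (le_trans _ (dual_normZ_le _ _))// scalerA mulVf// scale1r.
Qed.

Let dual_norm0_eq0 (f : dual) : dual_norm f = 0 -> f = 0.
Proof.
move=> f0; apply/val_inj/funext => x /=.
by apply/eqP; rewrite -normr_le0 (le_trans (le_dual_norm f x))// f0 mul0r.
Qed.

HB.instance Definition _ :=
  Lmodule_isNormed.Build R dual dual_normD dual_normZ dual_norm0_eq0.

End Dual.

(* The canonical embedding of [F] in its bidual, x |-> (f |-> f x), is onto. *)
Definition reflexive_space {R : realType} (F : normedModType R) : Prop :=
  forall phi : dual (dual F), exists x : F, forall f : dual F, phi f = f x.

Section BoundedFamilies.
Context {R : realType} (E : normedModType R) (A : Type).

Definition bounded_family_pred : {pred A -> E} :=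
  mem [set y : A -> E | bounded_fun y].

Record bounded_family := BoundedFamily {
  bfam_fun :> A -> E ;
  bfam_funP : bfam_fun \in bounded_family_pred }.

HB.instance Definition _ := [isSub for bfam_fun].
HB.instance Definition _ := [Choice of bounded_family by <:].

Lemma bounded_familyP (y : A -> E) :
  (exists M, forall a, `|y a| <= M) <-> y \in bounded_family_pred.
Proof.
rewrite inE; split=> [[M yM]|/pinfty_ex_gt0[M _ yM]].
  rewrite /= /bounded_near; near=> N; move=> a _ /=.
  by apply: (le_trans (yM a)); near: N; apply: nbhs_pinfty_ge; exact: num_real.
by exists M => a; exact: yM.
Unshelve. all: by end_near.
Qed.

Lemma bounded_family_submod_closed : submod_closed bounded_family_pred.
Proof.
split; first by apply/bounded_familyP; exists 0 => a; rewrite normr0.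
move=> c y z /bounded_familyP[M yM] /bounded_familyP[N zN].
apply/bounded_familyP; exists (`|c| * M + N) => a.
by rewrite (le_trans (ler_normD _ _))// lerD// normrZ ler_wpM2l.
Qed.

HB.instance Definition _ := GRing.isSubmodClosed.Build R (A -> E)
  bounded_family_pred bounded_family_submod_closed.
HB.instance Definition _ := [SubChoice_isSubLmodule of bounded_family by <:].

End BoundedFamilies.

Section Ultrapower.
Context {R : realType} (E : normedModType R) (A : Type) (xi : set_system A).
Context (xiU : UltraFilter xi).

(* The limit always exists (see [ultra_seminorm_cvg]), so that [lim] does not
   return its default value. *)
Definition ultra_seminorm (y : bounded_family E A) : R :=
  lim (`|y a| @[a --> xi]).

Lemma ultra_seminorm_cvg (y : bounded_family E A) :
  `|y a| @[a --> xi] --> ultra_seminorm y.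
Proof.
have /bounded_familyP[M yM] := bfam_funP y.
have yU : UltraFilter (`|y a| @[a --> xi]).
  split=> [|G GF yG]; first exact: fmap_proper_filter.
  apply/seteqP; split=> // B GB.
  have [//|xiB] := in_ultra_setVsetC ((fun a => `|y a|) @^-1` B) xiU.
  have GBC : G (~` B) by apply: yG.
  by exfalso; apply: (@filter_not_empty _ G _); rewrite -(setICr B); exact: filterI.
have := @segment_compact R 0 M; rewrite compact_ultra => /(_ _ yU) [].
  by apply: nearW => a /=; rewrite in_itv/= normr_ge0 yM.
move=> l [_ /= yl]; rewrite /ultra_seminorm; apply: (@cvgP R _ l); exact: yl.
Qed.

Lemma ultra_seminorm_ge0 y : 0 <= ultra_seminorm y.
Proof.
apply: (cvgr_to_ge (@ultra_seminorm_cvg y)).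
by apply: nearW => a; exact: normr_ge0.
Qed.

Lemma ultra_seminormD y z :
  ultra_seminorm (y + z) <= ultra_seminorm y + ultra_seminorm z.
Proof.
rewrite -subr_ge0; apply: (cvgr_to_ge (cvgB
  (cvgD (@ultra_seminorm_cvg y) (@ultra_seminorm_cvg z))
  (@ultra_seminorm_cvg (y + z)))).
by apply: nearW => a; rewrite subr_ge0; exact: ler_normD.
Qed.

Lemma ultra_seminormZ (c : R) y :
  ultra_seminorm (c *: y) = `|c| * ultra_seminorm y.
Proof.
apply: cvg_lim => //.
have -> : (fun a => `|(c *: y : bounded_family E A) a|)
          = (fun a => `|c| * `|y a|).
  by apply/funext => a; exact: normrZ.
by apply: cvgMl_tmp; exact: ultra_seminorm_cvg.
Qed.

Definition ultra_null : {pred bounded_family E A} :=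
  [pred y | ultra_seminorm y == 0].

Lemma ultra_null_submod_closed : submod_closed ultra_null.
Proof.
split.
  by rewrite inE/= -(scale0r (0 : bounded_family E A)) ultra_seminormZ normr0 mul0r.
move=> c y z; rewrite !inE/= => /eqP y0 /eqP z0.
rewrite eq_le ultra_seminorm_ge0 andbT (le_trans (ultra_seminormD _ _))//.
by rewrite ultra_seminormZ y0 z0 mulr0 addr0.
Qed.

HB.instance Definition _ := GRing.isSubmodClosed.Build R (bounded_family E A)
  ultra_null ultra_null_submod_closed.

Local Open Scope quotient_scope.

Definition ultrapower : Type := Quotient.quot ultra_null.

HB.instance Definition _ := Choice.on ultrapower.
HB.instance Definition _ := GRing.Zmodule.on ultrapower.

Definition ultra_class (y : bounded_family E A) : ultrapower :=
  \pi_(Quotient.quot ultra_null) y.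

Definition ultra_repr (x : ultrapower) : bounded_family E A :=
  repr (x : Quotient.quot ultra_null).

Lemma ultra_reprK : cancel ultra_repr ultra_class.
Proof. by move=> x; exact: reprK. Qed.

Lemma ultra_classP (y z : bounded_family E A) :
  ultra_class y = ultra_class z <-> ultra_seminorm (y - z) = 0.
Proof.
have := Quotient.idealrBE ultra_null y z; rewrite inE/= => yz.
by split=> [|/eqP]; [move/eqP; rewrite -yz => /eqP|rewrite yz => /eqP].
Qed.

Lemma ultra_classD y z : ultra_class (y + z) = ultra_class y + ultra_class z.
Proof. exact: (raddfD \pi_(Quotient.quot ultra_null)). Qed.

Definition ultra_scale (c : R) (x : ultrapower) : ultrapower :=
  ultra_class (c *: ultra_repr x).

Lemma ultra_scaleE c y : ultra_scale c (ultra_class y) = ultra_class (c *: y).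
Proof.
apply/ultra_classP; rewrite -scalerBr ultra_seminormZ.
suff -> : ultra_seminorm (ultra_repr (ultra_class y) - y) = 0 by rewrite mulr0.
by apply/ultra_classP; exact: ultra_reprK.
Qed.

Let ultra_scalerA a b x :
  ultra_scale a (ultra_scale b x) = ultra_scale (a * b) x.
Proof. by rewrite -(ultra_reprK x) !ultra_scaleE scalerA. Qed.

Let ultra_scale1r : left_id 1 ultra_scale.
Proof. by move=> x; rewrite -(ultra_reprK x) ultra_scaleE scale1r. Qed.

Let ultra_scalerDr : right_distributive ultra_scale +%R.
Proof.
move=> a x z; rewrite -(ultra_reprK x) -(ultra_reprK z).
by rewrite -ultra_classD !ultra_scaleE scalerDr ultra_classD.
Qed.

Let ultra_scalerDl x :
  {morph (fun a => ultra_scale a x) : a b / a + b >-> a + b}.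
Proof.
move=> a b; rewrite -(ultra_reprK x) !ultra_scaleE.
by rewrite scalerDl ultra_classD.
Qed.

HB.instance Definition _ := GRing.Zmodule_isLmodule.Build R ultrapower
  ultra_scalerA ultra_scale1r ultra_scalerDr ultra_scalerDl.

Definition ultra_norm (x : ultrapower) : R := ultra_seminorm (ultra_repr x).

Let ultra_seminorm_le y z :
  ultra_class y = ultra_class z -> ultra_seminorm y <= ultra_seminorm z.
Proof.
move=> /ultra_classP yz0.
by rewrite -(subrK z y) (le_trans (ultra_seminormD _ _))// yz0 add0r.
Qed.

Lemma ultra_normE y : ultra_norm (ultra_class y) = ultra_seminorm y.
Proof. by apply/eqP; rewrite eq_le !ultra_seminorm_le// ultra_reprK. Qed.

Let ultra_normD x z : ultra_norm (x + z) <= ultra_norm x + ultra_norm z.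
Proof.
rewrite -(ultra_reprK x) -(ultra_reprK z) -ultra_classD !ultra_normE.
exact: ultra_seminormD.
Qed.

Let ultra_normZ (a : R) x : ultra_norm (a *: x) = `|a| * ultra_norm x.
Proof. by rewrite ultra_normE ultra_seminormZ. Qed.

Let ultra_norm0_eq0 x : ultra_norm x = 0 -> x = 0.
Proof.
move=> x0; rewrite -(ultra_reprK x) -[0]ultra_reprK; apply/ultra_classP.
have -> : ultra_repr x - ultra_repr 0 = ultra_repr x + -1 *: ultra_repr 0.
  by rewrite scaleN1r.
apply/eqP; rewrite eq_le ultra_seminorm_ge0 andbT.
rewrite (le_trans (ultra_seminormD _ _))// ultra_seminormZ normrN1 mul1r.
rewrite -/(ultra_norm x) x0 add0r -/(ultra_norm 0) -(scale0r (0 : ultrapower)).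
by rewrite ultra_normZ normr0 mul0r.
Qed.

HB.instance Definition _ :=
  Lmodule_isNormed.Build R ultrapower ultra_normD ultra_normZ ultra_norm0_eq0.

Lemma ultrapower_normE y : `|ultra_class y| = ultra_seminorm y.
Proof. exact: ultra_normE. Qed.

End Ultrapower.

(* Completeness of the ultrapowers is not asked separately: a reflexive normed
   space is isometric to a dual, hence complete. *)
Definition superreflexive {R : realType} (E : normedModType R) : Prop :=
  forall (A : Type) (xi : set_system A) (xiU : UltraFilter xi),
    reflexive_space (ultrapower E xiU).

(* Main.v *)
Require Import Defs.
From HB Require Import structures.
From mathcomp Require Import all_boot all_order all_algebra.
From mathcomp Require Import all_classical all_reals all_analysis.
From mathcomp Require Import lra.

Set Implicit Arguments.
Unset Strict Implicit.
Unset Printing Implicit Defensive.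

Import Order.TTheory GRing.Theory Num.Theory.
Import numFieldNormedType.Exports.

Local Open Scope classical_set_scope.
Local Open Scope ring_scope.

(** Maps into reflexive spaces obey Kalton's interlacing inequality, which
    prevents them from being uniform embeddings of the space [c_0] of null
    sequences, or even of its eventually null rational sequences; and the
    Urysohn space contains a copy of the latter.

    Let [F] be reflexive, and [f] a bounded map from [k]-tuples of naturals
    to [F].  Take weak limits of [f] along a free ultrafilter in the
    last index, then in the last but one, and so on down to a single vector
    [x].  Let [h m] be a functional of norm at most [1] with
    [h m (f m - x) = |f m - x|], and form the analogous tree of weak-star limits
    of [h].  Choosing [m_1 < n_1 < m_2 < n_2 < ...] one at a time, each far
    enough along the ultrafilter, keeps the pairing of the current node of the
    [h]-tree with the difference of the current node of the [x]-tree and [x]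
    as small as desired; at the leaves this says
    that [h m (f n - x)] is small, whence [|f m - x|] is at most [|f m - f n|]
    up to an arbitrarily small error ([interlacing_center]).  So if [f] moves
    interlaced tuples little, it takes values close to [x] on tuples situated
    arbitrarily far out, and in particular on two tuples one of which lies
    entirely beyond the other.

    On the other hand, let [s_n] be the sequence whose first [n] entries are
    [1] and whose other entries are [0].  The averages [(s_{m_1} + ... +
    s_{m_k}) / k] for two interlaced tuples differ by at most [1 / k] in the
    sup norm, but are at distance at least [1] when one tuple lies beyond the
    other.  These averages live in the countable space of eventually null
    rational sequences, which embeds isometrically into the Urysohn space.
    A uniform embedding into [E], for [k] large, moves interlaced tuples
    little and separates the others, which is impossible if [E] sits in a
    reflexive space.  If [E] is superreflexive, the diagonal map sends it isometrically
    into a reflexive ultrapower ([ultrapower_diagonal]).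

    Norming functionals come from the analytic Hahn-Banach theorem,
    in the form that a minimal sublinear functional is linear
    ([minimal_sublinear_linear]). *)

(** * Norming functionals *)

Section Sublinear.
Context {R : realType} {V : lmodType R}.
Implicit Types (p q : V -> R) (x y z : V).

Definition sublinear p :=
  (forall y z, p (y + z) <= p y + p z) /\
  (forall c y, 0 <= c -> p (c *: y) <= c * p y).

Lemma sublinear0 p : sublinear p -> p 0 = 0.
Proof.
move=> [pD pZ]; apply/eqP; rewrite eq_le.
have := pZ 0 0 (lexx _); rewrite scale0r mul0r => -> /=.
by have := pD 0 0; rewrite addr0 lerDl.
Qed.

Lemma sublinearZ p c y : sublinear p -> 0 <= c -> p (c *: y) = c * p y.
Proof.
move=> sp; rewrite le_eqVlt => /predU1P[<-|c0].
  by rewrite scale0r mul0r sublinear0.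
apply/eqP; rewrite eq_le (sp.2 _ _ (ltW c0))/= -ler_pdivlMl//.
have := sp.2 c^-1 (c *: y); rewrite scalerA mulVf ?gt_eqF// scale1r; apply.
by rewrite invr_ge0 ltW.
Qed.

Lemma sublinear_ge p y : sublinear p -> - p (- y) <= p y.
Proof.
move=> sp; have := sp.1 y (- y); rewrite subrr sublinear0//; lra.
Qed.

(** For sublinear [p], the largest sublinear minorant of [p] whose value at
    [- x] is at most [- p x]; equivalently, the largest one that is linear on
    the line of [x] and agrees with [p] at [x]. *)
Definition linear_along p x y : R :=
  inf [set p (y + t *: x) - t * p x | t in [set t | 0 <= t]].

Lemma linear_along_ub p x y t : sublinear p -> 0 <= t ->
  linear_along p x y <= p (y + t *: x) - t * p x.
Proof.
move=> sp t0; apply: ge_inf; last by exists t.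
exists (- p (- y)) => _ [s /= s0 <-].
rewrite -sublinearZ//; have := sp.1 (y + s *: x) (- y).
rewrite addrAC subrr add0r; lra.
Qed.

Lemma le_linear_along p x y b :
  (forall t, 0 <= t -> b <= p (y + t *: x) - t * p x) -> b <= linear_along p x y.
Proof.
move=> bP; apply: lb_le_inf; first by exists (p (y + 0 *: x) - 0 * p x), 0 => /=.
by move=> _ [t /= t0 <-]; exact: bP.
Qed.

Lemma linear_along_le p x y : sublinear p -> linear_along p x y <= p y.
Proof.
by move=> /linear_along_ub - /(_ x y _ (lexx _)); rewrite scale0r mul0r addr0 subr0.
Qed.

Lemma linear_along_sublinear p x : sublinear p -> sublinear (linear_along p x).
Proof.
move=> sp; split=> [y z|c y].
  rewrite -lerBlDr; apply: le_linear_along => t t0.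
  rewrite lerBlDr -lerBlDl; apply: le_linear_along => s s0.
  rewrite lerBlDl (le_trans (linear_along_ub _ _ sp (addr_ge0 t0 s0)))//.
  have := sp.1 (y + t *: x) (z + s *: x).
  by rewrite addrACA -scalerDl mulrDl; lra.
rewrite le_eqVlt => /predU1P[<-|c0].
  by rewrite scale0r mul0r (le_trans (linear_along_le _ _ sp))// sublinear0.
rewrite -ler_pdivrMl//; apply: le_linear_along => t t0.
rewrite ler_pdivrMl// mulrBr -(sublinearZ (y + _) sp (ltW c0)).
rewrite scalerDr scalerA mulrA.
by apply: linear_along_ub => //; rewrite mulr_ge0// ltW.
Qed.

(** Zorn's lemma: the pointwise infimum of a chain of sublinear minorants of
    [q] is finite because [- q (- y)] bounds all of them from below at [y], and
    it is subadditive because any two members of the chain are comparable. *)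
Lemma minimal_sublinear q : sublinear q ->
  exists p, [/\ sublinear p, forall y, p y <= q y &
    forall p', sublinear p' -> (forall y, p' y <= p y) -> p' = p].
Proof.
move=> sq.
pose T := {p : V -> R | sublinear p /\ forall y, p y <= q y}.
pose r (s t : T) := `[< forall y, sval t y <= sval s y >].
have rP s t : reflect (forall y, sval t y <= sval s y) (r s t) by exact: asboolP.
have [||||[p [sp pq]] pmin] := @Zorn T r.
- by move=> t; apply/rP.
- by move=> s t u /rP ts /rP ut; apply/rP => y; exact: le_trans (ut y) (ts y).
- move=> [s sP] [t tP] /rP/= ts /rP/= st; apply: eq_exist; apply/funext => y.
  by apply/eqP; rewrite eq_le ts st.
- move=> A Atot; have [[s0 As0]|A0] := pselect (exists s, A s); last first.
    exists (exist _ q (conj sq (fun=> lexx _))) => s As.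
    by exfalso; apply: A0; exists s.
  pose m y := inf [set sval s y | s in A].
  have m_le s y : A s -> m y <= sval s y.
    move=> As; apply: ge_inf; last by exists s.
    exists (- q (- y)) => _ [[p [sp pq]] /= _ <-].
    by apply: le_trans (sublinear_ge _ sp); rewrite lerN2 pq.
  have le_m y b : (forall s, A s -> b <= sval s y) -> b <= m y.
    move=> bP; apply: lb_le_inf; first by exists (sval s0 y), s0.
    by move=> _ [s As <-]; exact: bP.
  suff sm : sublinear m /\ forall y, m y <= q y.
    by exists (exist _ m sm) => s As; apply/rP => y; exact: m_le.
  split; last by move=> y; apply: le_trans (m_le _ _ As0) ((svalP s0).2 y).
  split=> [y z|c y].
    rewrite -lerBlDr; apply: (le_m) => s As.
    rewrite lerBlDr -lerBlDl; apply: (le_m) => t At.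
    rewrite lerBlDl; have [/rP st|/rP ts] := Atot _ _ As At.
      rewrite (le_trans (m_le _ _ At))// (le_trans ((svalP t).1.1 _ _))//.
      by rewrite lerD.
    rewrite (le_trans (m_le _ _ As))// (le_trans ((svalP s).1.1 _ _))//.
    by rewrite lerD.
  rewrite le_eqVlt => /predU1P[<-|c0].
    rewrite scale0r mul0r -(sublinear0 (svalP s0).1); exact: m_le.
  rewrite -ler_pdivrMl//; apply: (le_m) => s As.
  by rewrite ler_pdivrMl// (le_trans (m_le _ _ As))// (svalP s).1.2// ltW.
exists p; split=> // p' sp' p'p.
have p'q y : p' y <= q y by exact: le_trans (p'p y) (pq y).
have := pmin (exist _ p' (conj sp' p'q)) => /(_ _)/(congr1 sval)/=; apply.
exact/rP.
Qed.

(** By minimality [linear_along p x = p] for all [x], and the parameter [t = 1]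
    in the infimum turns this equality into superadditivity of [p]. *)
Lemma minimal_sublinear_linear p : sublinear p ->
  (forall p', sublinear p' -> (forall y, p' y <= p y) -> p' = p) ->
  linear (p : V -> R^o).
Proof.
move=> sp pmin.
have pD y z : p (y + z) = p y + p z.
  apply/eqP; rewrite eq_le sp.1 /=.
  have := linear_along_ub z y sp ler01.
  rewrite (pmin _ (linear_along_sublinear z sp) (fun y => linear_along_le z y sp)).
  by rewrite scale1r mul1r -lerBrDr.
have pN y : p (- y) = - p y.
  by have := pD y (- y); rewrite subrr sublinear0//; lra.
move=> c y z; rewrite pD; congr (_ + _).
have [c0|c0] := leP 0 c; first by rewrite sublinearZ.
by rewrite -[c]opprK scaleNr pN sublinearZ ?oppr_ge0 ?ltW// scaleNr.
Qed.

End Sublinear.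

Section Dual.
Context {R : realType} {F : normedModType R}.

Lemma bounded_form_continuous (h : F -> R^o) M : linear h ->
  (forall y, `|h y| <= M * `|y|) -> continuous h.
Proof.
move=> lh hM.
pose g : {linear F -> R^o} := HB.pack h
  (GRing.isLinear.Build R F R^o *:%R h lh).
suff : continuous g by [].
apply/linear_bounded_continuous/linear_boundedP.
by near=> r => y; rewrite (le_trans (hM y))// ler_wpM2r.
Unshelve. all: by end_near.
Qed.

(** A minimal sublinear functional below [linear_along] of the norm is linear,
    is dominated by the norm, and is at most [- |x|] at [- x]. *)
Lemma norming_functional (x : F) :
  exists h : dual F, (forall y, `|h y| <= `|y|) /\ h x = `|x|.
Proof.
have sN : sublinear (fun y : F => `|y|).
  split=> [y z|c y c0]; first exact: ler_normD.
  by rewrite normrZ ger0_norm.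
have [p [sp pq pmin]] := minimal_sublinear (linear_along_sublinear x sN).
have lp := minimal_sublinear_linear sp pmin.
have py y : p y <= `|y| := le_trans (pq y) (linear_along_le x y sN).
have pN y : p (- y) = - p y.
  by have := lp (-1) y 0; rewrite scaleN1r scaleN1r !addr0 (sublinear0 sp) addr0.
have py' y : `|p y| <= `|y|.
  by rewrite ler_norml py andbT -lerN2 opprK -pN -(normrN y) py.
have cp : continuous (p : F -> R^o).
  by apply: (@bounded_form_continuous _ 1) => // y; rewrite mul1r.
exists (Dual (mem_set (conj lp cp))); split=> //=.
apply/eqP; rewrite eq_le py/= -lerN2 -pN (le_trans (pq _))//.
have := linear_along_ub x (- x) sN ler01.
by rewrite scale1r addNr normr0 mul1r sub0r.
Qed.

End Dual.

(** * Limits along an ultrafilter in a space and in its dual *)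

Section UltraLimit.
Context {R : realType} (xi : set_system nat) (xiU : UltraFilter xi).

(** Bounded nonnegative families converge along an ultrafilter, as the
    seminorm of the ultrapower of the real line exists; a translation by the
    bound reduces to that case. *)
Lemma ultra_cvg (u : nat -> R) M : (forall n, `|u n| <= M) ->
  exists l : R, u n @[n --> xi] --> l.
Proof.
move=> uM; pose v n : R^o := u n + M.
have /bounded_familyP vP : exists N, forall n, `|v n| <= N.
  exists (M + M) => n.
  by rewrite (le_trans (ler_normD _ _))// lerD// ger0_norm// (le_trans _ (uM n)).
have := @ultra_seminorm_cvg _ _ _ _ xiU (BoundedFamily vP).
set l := ultra_seminorm _ _ => vl; exists (l - M).
have -> : u = (fun n => `|u n + M| - M).
  apply/funext => n; rewrite ger0_norm ?addrK//.
  by have := uM n; rewrite ler_norml; lra.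
by apply: cvgB; [exact: vl|exact: cvg_cst].
Qed.

Lemma ultra_limit_form (W : normedModType R) (g : nat -> W -> R^o) M :
  (forall n, linear (g n)) -> (forall n y, `|g n y| <= M * `|y|) ->
  exists h : dual W, (forall y, `|h y| <= M * `|y|) /\
    forall y, g n y @[n --> xi] --> h y.
Proof.
move=> lg gM.
have /choice[h gh] y : exists l : R^o, g n y @[n --> xi] --> l.
  by apply: ultra_cvg => n; exact: gM.
have hM y : `|h y| <= M * `|y|.
  have /cvgr_to_le : `|g n y| @[n --> xi] --> `|h y|.
    by apply: cvg_norm; exact: gh.
  by apply; exact: nearW.
have lh : linear (h : W -> R^o).
  move=> a y z; apply: (@cvg_unique _ _ (g n (a *: y + z) @[n --> xi])) => //=.
  have -> : (fun n => g n (a *: y + z)) = (fun n => a *: g n y + g n z).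
    by apply/funext => n; exact: lg.
  by apply: cvgD; [apply: cvgZl_tmp; exact: gh|exact: gh].
have ch := bounded_form_continuous lh hM.
by exists (Dual (mem_set (conj lh ch))).
Qed.

(** The weak-star compactness of the dual unit ball. *)
Lemma ultra_weakstar_limit (W : normedModType R) (g : nat -> dual W) :
  (forall n y, `|g n y| <= `|y|) ->
  exists h : dual W, (forall y, `|h y| <= `|y|) /\
    forall y, g n y @[n --> xi] --> h y.
Proof.
move=> gM; have [||h [hM gh]] := @ultra_limit_form W g 1.
- by move=> n; exact: dual_linear.
- by move=> n y; rewrite mul1r.
by exists h; split=> // y; rewrite -[leRHS]mul1r.
Qed.

(** The limits of [h (u n)] form a bounded linear functional of [h], and
    reflexivity is precisely what represents it by a vector.  Without the norm
    bound on this vector the construction of limits could not be iterated. *)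
Lemma ultra_weak_limit (F : normedModType R) (u : nat -> F) M :
  reflexive_space F -> (forall n, `|u n| <= M) ->
  exists x : F, `|x| <= M /\ forall h : dual F, h (u n) @[n --> xi] --> h x.
Proof.
move=> reflF uM.
have [||phi [_ uphi]] := @ultra_limit_form (dual F) (fun n h => h (u n)) M.
- by [].
- by move=> n h; rewrite (le_trans (le_dual_norm h _))// mulrC ler_wpM2r// dual_norm_ge0.
have [x phix] := reflF phi.
have ux (h : dual F) : h (u n) @[n --> xi] --> h x by rewrite -phix.
exists x; split=> //; have [h [hle <-]] := norming_functional x.
apply: (cvgr_to_le (ux h)); apply: nearW => n.
by rewrite (le_trans (ler_norm _))// (le_trans (hle _)).
Qed.

End UltraLimit.

(** * Interlaced tuples in a reflexive space *)

Section Trees.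

(** Prescribed values at the tuples of length [k] extend to shorter tuples by
    iterated limits, from the leaves to the root: [W u x] reads [x] is a limit
    of [u], and [P] is a bound that limits inherit.  The abstract form covers
    both weak limits of vectors and weak-star limits of functionals. *)
Lemma limit_tree (T : Type) (P : T -> Prop) (W : (nat -> T) -> T -> Prop) :
  (forall u, (forall n, P (u n)) -> exists x, P x /\ W u x) ->
  forall k (f : seq nat -> T), (forall p, size p = k -> P (f p)) ->
  exists t : seq nat -> T,
    (forall p, size p = k -> t p = f p) /\
    (forall p, (size p < k)%N -> W (fun n => t (rcons p n)) (t p)).
Proof.
move=> PW; elim=> [|k IH] f Pf; first by exists f.
have /choice[g gP] p : exists x,
    size p = k -> P x /\ W (fun n => f (rcons p n)) x.
  have [pk|pk] := eqVneq (size p) k; last first.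
    by exists (f p) => /eqP; rewrite (negPf pk).
  have [|x [Px Wx]] := PW (fun n => f (rcons p n)); last by exists x.
  by move=> n; apply: Pf; rewrite size_rcons pk.
have [|t [tg tW]] := IH g; first by move=> p /gP[].
exists (fun p => if size p == k.+1 then f p else t p); split=> p.
  by move=> ->; rewrite eqxx.
move=> pk; rewrite (ltn_eqF pk).
have -> : (fun n => if size (rcons p n) == k.+1 then f (rcons p n)
                    else t (rcons p n)) =
          (fun n => if size p == k then f (rcons p n) else t (rcons p n)).
  by apply/funext => n; rewrite size_rcons eqSS.
have [pk'|pk'] := eqVneq (size p) k; last first.
  by apply: tW; rewrite ltn_neqAle pk' -ltnS.
by rewrite tg//; have [] := gP _ pk'.
Qed.

Context {R : realType} (xi : set_system nat) (xiU : UltraFilter xi).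
Hypothesis xi_free : \oo `<=` xi.
Context (F : normedModType R).

(** For increasing [m] and [n] of the same length this says that [m_i <= n_i <=
    m_{i+1}].  Counting the entries above each threshold is the form in which
    the sup norm sees the condition. *)
Definition interlaced (m n : seq nat) := forall t,
  (count (ltn t) m <= count (ltn t) n <= (count (ltn t) m).+1)%N.

Lemma interlaced_rcons (m n : seq nat) b i j :
  all (geq b) m -> all (geq b) n -> (b < i)%N -> (i < j)%N ->
  interlaced m n -> interlaced (rcons m i) (rcons n j).
Proof.
move=> mb nb bi ij mn t; rewrite -!cats1 !count_cat/= !addn0.
have [ti|it] := ltnP t i.
  by rewrite (ltn_trans ti ij) !addn1 !ltnS.
have count0 s : all (geq b) s -> count (ltn t) s = 0%N.
  move=> /allP sb; apply/eqP; rewrite -leqn0 leqNgt -has_count.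
  apply/negP => /hasP[l /sb/= lb]; rewrite ltnNge.
  by rewrite (leq_trans lb)// (leq_trans (ltnW bi)).
by rewrite !count0//= !add0n; case: (t < j)%N.
Qed.

(** The entries are chosen in the order [m_1], [n_1], [m_2], [n_2], and so on.
    A new last entry of [m] changes the functional in the pairing of [h m] with
    [x n - x [::]], while a new last entry of [n] changes the vector; for either
    one the pairing converges, along the ultrafilter, to its previous value, and
    to be less than [e] is an open condition.  At the root the pairing is [0]. *)
Lemma interlaced_choice (x : seq nat -> F) (h : seq nat -> dual F) k :
  (forall p, (size p < k)%N -> forall g : dual F,
     g (x (rcons p n)) @[n --> xi] --> g (x p)) ->
  (forall p, (size p < k)%N -> forall y,
     h (rcons p n) y @[n --> xi] --> h p y) ->
  forall N (e : R), 0 < e -> exists m n,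
    [/\ size m = k, size n = k, all (ltn N) m, interlaced m n &
        `|h m (x n - x [::])| < e].
Proof.
move=> xW hW N e e0.
have hB (g : dual F) y z : g (y - z) = g y - g z.
  have := dual_linear g (-1) z y; rewrite !scaleN1r.
  by rewrite !(addrC (- _)) => ->.
(* The number b bounds the entries chosen so far, and is at least N, so that
   the next entry exceeds N. *)
suff /(_ _ (leqnn k)) [m [n [b [? ? ? [_ _ _ ?] ?]]]] : forall j, (j <= k)%N ->
    exists m n b, [/\ size m = j, size n = j, all (ltn N) m,
    [/\ (N <= b)%N, all (geq b) m, all (geq b) n & interlaced m n] &
    `|h m (x n - x [::])| < e].
  by exists m, n.
elim=> [_|j IH jk].
  exists [::], [::], N; split=> //.
  by rewrite hB subrr normr0.
have [m [n [b [mj nj Nm [Nb mb nb mn] hmn]]]] := IH (ltnW jk).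
have big c : \forall i \near xi, (c < i)%N by apply: xi_free; exists c.+1.
have [|i []] := @filter_ex _ xi _ [set i | (b < i)%N /\
    `|h (rcons m i) (x n - x [::])| < e].
  apply: filterI; first exact: big.
  by apply: cvgr_norm_lt hmn; apply: hW; rewrite mj.
move=> bi hi.
have [|l []] := @filter_ex _ xi _ [set l | (i < l)%N /\
    `|h (rcons m i) (x (rcons n l) - x [::])| < e].
  apply: filterI; first exact: big.
  apply: cvgr_norm_lt hi; rewrite hB.
  under eq_fun do rewrite hB.
  by apply: cvgB; [apply: xW; rewrite nj|exact: cvg_cst].
move=> il hl; exists (rcons m i), (rcons n l), l.
split=> //; rewrite ?size_rcons ?mj ?nj//.
  by rewrite all_rcons Nm/= (leq_ltn_trans Nb bi).
have bl : (b <= l)%N by rewrite ltnW// (ltn_trans bi).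
split; rewrite ?all_rcons/= ?leqnn ?(ltnW il)/=.
- exact: leq_trans Nb bl.
- by apply: sub_all mb => c /= cb; exact: leq_trans bl.
- by apply: sub_all nb => c /= cb; exact: leq_trans bl.
- exact: interlaced_rcons mb nb bi il mn.
Qed.

(** Kalton's inequality: [|f m - x|] is the value at [f m - x] of a contractive
    functional [h m], which splits into [h m (f m - f n)] and
    [h m (f n - x)]; the latter is made small by [interlaced_choice]. *)
Lemma interlacing_center (f : seq nat -> F) k M : reflexive_space F ->
  (forall p, size p = k -> `|f p| <= M) ->
  exists x : F, forall N e, 0 < e -> exists m n,
    [/\ size m = k, size n = k, all (ltn N) m, interlaced m n &
        `|f m - x| < `|f m - f n| + e].
Proof.
move=> reflF fM.
have [x [xf xW]] := limit_tree (fun u => @ultra_weak_limit _ _ xiU F u M reflF) fM.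
have /choice[g gP] p : exists g : dual F,
  (forall y, `|g y| <= `|y|) /\ g (f p - x [::]) = `|f p - x [::]|.
  exact: norming_functional.
have [h [hg hW]] := limit_tree (@ultra_weakstar_limit _ _ xiU F)
  (fun p (_ : size p = k) => (gP p).1).
exists (x [::]) => N e e0.
have [m [n [mk nk Nm mn hmn]]] := interlaced_choice xW hW N e0.
exists m, n; split=> //; move: hmn; rewrite hg// xf//.
have [gle gm] := gP m; rewrite -gm.
have -> : g m (f m - x [::]) = g m (f m - f n) + g m (f n - x [::]).
  have := dual_linear (g m) 1 (f m - f n) (f n - x [::]).
  by rewrite !scale1r addrA subrK.
move=> hmn; rewrite ler_ltD//.
  by rewrite (le_trans (ler_norm _)).
exact: le_lt_trans (ler_norm _) _.
Qed.

End Trees.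

(** * Rational sequences with finite support *)

Section SupNorm.
Implicit Types P Q : {poly rat}.

Definition supnorm P : rat := \big[Num.max/0]_(i < size P) `|P`_i|.

Lemma coef_le_supnorm P i : `|P`_i| <= supnorm P.
Proof.
have [iP|iP] := ltnP i (size P).
  exact: (le_bigmax _ (fun i : 'I_(size P) => `|P`_i|) (Ordinal iP)).
by rewrite nth_default// normr0; exact: bigmax_ge_id.
Qed.

Lemma supnorm_le P b : 0 <= b -> (forall i, `|P`_i| <= b) -> supnorm P <= b.
Proof. by move=> b0 Pb; apply: bigmax_le. Qed.

Lemma supnorm_ge0 P : 0 <= supnorm P.
Proof. exact: le_trans (coef_le_supnorm P 0). Qed.

Lemma supnorm0 : supnorm 0 = 0.
Proof.
apply/eqP; rewrite eq_le supnorm_ge0 andbT.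
by apply: supnorm_le => // i; rewrite coef0 normr0.
Qed.

Lemma supnorm_eq0 P : supnorm P = 0 -> P = 0.
Proof.
move=> P0; apply/polyP => i; apply/eqP.
by rewrite coef0 -normr_le0 (le_trans (coef_le_supnorm _ _))// P0.
Qed.

Lemma supnormN P : supnorm (- P) = supnorm P.
Proof.
have le Q : supnorm (- Q) <= supnorm Q.
  by apply: supnorm_le => [|i]; rewrite ?supnorm_ge0// coefN normrN coef_le_supnorm.
by apply/eqP; rewrite eq_le le/= -{1}(opprK P) le.
Qed.

Lemma supnormD P Q : supnorm (P + Q) <= supnorm P + supnorm Q.
Proof.
apply: supnorm_le => [|i]; first by rewrite addr_ge0 ?supnorm_ge0.
by rewrite coefD (le_trans (ler_normD _ _))// lerD// coef_le_supnorm.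
Qed.

End SupNorm.

(** The real field is a phantom parameter that fixes where distances take their
    values. *)
Definition c00 (R : realType) : Type := {poly rat}.
HB.instance Definition _ (R : realType) := Choice.on (c00 R).

Section C00.
Context {R : realType}.
Implicit Types P Q : c00 R.

Definition c00_dist P Q : R := ratr (supnorm (P - Q : {poly rat})).

Let c00_distxx P : c00_dist P P = 0.
Proof. by rewrite /c00_dist subrr supnorm0 rmorph0. Qed.

Let c00_dist_eq0 P Q : c00_dist P Q = 0 -> P = Q.
Proof.
by move/eqP; rewrite fmorph_eq0 => /eqP/supnorm_eq0/eqP; rewrite subr_eq0 => /eqP.
Qed.

Let c00_dist_sym P Q : c00_dist P Q = c00_dist Q P.
Proof. by rewrite /c00_dist -supnormN opprB. Qed.

Let c00_dist_triangle Q P S : c00_dist P S <= c00_dist P Q + c00_dist Q S.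
Proof.
rewrite /c00_dist -rmorphD ler_rat.
have -> : (P - S : {poly rat}) = (P - Q : {poly rat}) + (Q - S : {poly rat}).
  by rewrite addrA subrK.
exact: supnormD.
Qed.

HB.instance Definition _ := isMetric.Build R (c00 R)
  c00_distxx c00_dist_eq0 c00_dist_sym c00_dist_triangle.

Lemma c00_mdistE P Q : mdist P Q = ratr (supnorm (P - Q : {poly rat})).
Proof. by []. Qed.

Lemma c00_mdist_le P Q k :
  supnorm (P - Q : {poly rat}) <= k%:R^-1 -> mdist P Q <= k%:R^-1.
Proof. by move=> PQ; rewrite c00_mdistE -(ratr_nat R k) -fmorphV ler_rat. Qed.

Lemma c00_separable : separable (c00 R).
Proof.
exists setT; last by move=> O O0 _; rewrite setIT.
exact: (@countableP {poly rat}).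
Qed.

End C00.

(** A polynomial stands for the sequence of its coefficients, so that
    [\poly_(t < i) 1] is the indicator of the first [i] indices. *)
Definition staircase (k : nat) (p : seq nat) : {poly rat} :=
  k%:R^-1 *: \sum_(i <- p) \poly_(t < i) 1.

Lemma coef_staircase k p t :
  (staircase k p)`_t = (count (ltn t) p)%:R / k%:R.
Proof.
rewrite coefZ coef_sum mulrC; congr (_ * _).
elim: p => [|i p IH]; first by rewrite big_nil.
rewrite big_cons IH coef_poly/= natrD; case: (t < i)%N => //=.
Qed.

Lemma supnorm_staircase k p : size p = k -> supnorm (staircase k p) <= 1.
Proof.
move=> pk; apply: supnorm_le => // t.
rewrite coef_staircase ger0_norm ?divr_ge0//.
have [->|k0] := posnP k; first by rewrite invr0 mulr0.
by rewrite ler_pdivrMr ?ltr0n// mul1r ler_nat -pk count_size.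
Qed.

Lemma staircase_interlaced k m n : interlaced m n ->
  supnorm (staircase k m - staircase k n) <= k%:R^-1.
Proof.
move=> mn; apply: supnorm_le => [|t]; first by rewrite invr_ge0.
rewrite coefB !coef_staircase -mulrBl normrM normfV normr_nat.
rewrite ler_piMl ?invr_ge0// distrC.
have /andP[le_mn le_nm] := mn t.
by rewrite -natrB// normr_nat lern1 leq_subLR addn1.
Qed.

Lemma staircase_separated k m n b : (0 < k)%N -> size n = k ->
  all (geq b) m -> all (ltn b) n ->
  1 <= supnorm (staircase k m - staircase k n).
Proof.
move=> k0 nk mb bn; apply: le_trans (coef_le_supnorm _ b).
rewrite coefB !coef_staircase.
have -> : count (ltn b) m = 0%N.
  apply/eqP; rewrite -leqn0 leqNgt -has_count; apply/negP => /hasP[l /(allP mb)/= lb].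
  by rewrite /= ltnNge lb.
have /eqP -> : count (ltn b) n == k by rewrite -nk -all_count.
by rewrite mul0r sub0r normrN divff ?normr1// pnatr_eq0 -lt0n.
Qed.

(** * Uniform embeddings of the Urysohn space *)

(** The inverse map is only given on the range, with the uniformity induced by
    the codomain; this turns its continuity into an inequality upstairs. *)
Lemma uniform_embedding_moduli (R : realType) (X : metricType R)
    (Y : normedModType R) (f : X -> Y) : uniform_embedding f ->
  (forall e : R, 0 < e -> exists2 d : R, 0 < d &
     forall x y, mdist x y < d -> `|f x - f y| < e) /\
  (forall e : R, 0 < e -> exists2 d : R, 0 < d &
     forall x y, `|f x - f y| < d -> mdist x y < e).
Proof.
move=> [finj fcont [g fg gcont]]; split=> e e0.
  have /fcont : entourage [set xy : Y * Y | ball xy.1 e xy.2].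
    exact: (@entourage_ball _ _ (PosNum e0)).
  rewrite nbhs_simpl/= -entourage_ballE => -[d /= d0 dP]; exists d => // x y xy.
  have /dP/= : [set xy : X * X | ball xy.1 d xy.2] (x, y) by rewrite /= ballEmdist.
  by rewrite -ball_normE.
have /gcont : entourage [set xy : X * X | ball xy.1 e xy.2].
  exact: (@entourage_ball _ _ (PosNum e0)).
rewrite nbhs_simpl/= => -[B + BP].
rewrite -entourage_ballE => -[d /= d0 dB]; exists d => // x y xy.
have fR z : f z \in range f by apply/mem_set; exists z.
have gf z : g (exist _ (f z) (fR z)) = z by apply: finj; rewrite fg.
have Bxy : B (f x, f y) by apply: dB => /=; rewrite -ball_normE.
have := BP (exist _ (f x) (fR x), exist _ (f y) (fR y)) Bxy.
by rewrite /= !gf ballEmdist.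
Qed.

Section ConstantFamilies.
Context {R : realType} (E : normedModType R) (A : Type) (xi : set_system A).
Context (xiU : UltraFilter xi).

(** The ultralimit of a constant family of norms is this constant. *)
Lemma ultrapower_diagonal : exists i : E -> ultrapower E xiU,
  forall x y, `|i x - i y| = `|x - y|.
Proof.
have cb (x : E) : exists M, forall a : A, `|cst x a| <= M by exists `|x|.
pose c (x : E) := BoundedFamily ((bounded_familyP _).1 (cb x)).
exists (fun x => ultra_class xiU (c x)) => x y.
have -> : ultra_class xiU (c x) - ultra_class xiU (c y) = ultra_class xiU (c x - c y).
  by apply/eqP; rewrite subr_eq -ultra_classD subrK.
rewrite ultrapower_normE; apply: cvg_lim => //; exact: cvg_cst.
Qed.

End ConstantFamilies.

(** A segment from [0] to a point of the unit ball is cut into steps so short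
    that each moves the image by at most [e]. *)
Lemma unif_continuous_bounded_on_c00_ball (R : realType) (V : normedModType R)
    (G : c00 R -> V) (d e : R) : 0 < d ->
  (forall P Q, mdist P Q < d -> `|G P - G Q| <= e) ->
  exists M, forall P : c00 R, supnorm P <= 1 -> `|G P| <= M.
Proof.
move=> d0 Gd; have [k _ /= /(_ _ (leqnn k)) kd] := near_infty_natSinv_lt (PosNum d0).
exists (k.+1%:R * e + `|G (0 : {poly rat})|) => P P1.
pose Q n : c00 R := (n%:R / k.+1%:R : rat) *: (P : {poly rat}).
have QG n : `|G (Q n) - G (Q 0)| <= n%:R * e.
  elim: n => [|n IH]; first by rewrite subrr normr0 mul0r.
  rewrite -natr1 mulrDl mul1r -(subrKA (G (Q n))) (le_trans (ler_normD _ _))//.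
  rewrite addrC lerD//; apply: Gd; apply: le_lt_trans kd; apply: c00_mdist_le.
  have -> : (Q n.+1 : {poly rat}) - Q n = k.+1%:R^-1 *: (P : {poly rat}).
    by rewrite -scalerBl -mulrBl -natr1 addrAC subrr add0r mul1r.
  apply: supnorm_le => [|t]; first by rewrite invr_ge0.
  rewrite coefZ normrM normfV normr_nat ler_piMr ?invr_ge0//.
  exact: le_trans (coef_le_supnorm _ _) P1.
have QP : Q k.+1 = P by rewrite /Q divff ?pnatr_eq0// scale1r.
have Q0 : Q 0 = 0 :> {poly rat} by rewrite /Q mul0r scale0r.
have := QG k.+1; rewrite QP Q0 => PG.
by rewrite -(subrK (G (0 : {poly rat})) (G P)) (le_trans (ler_normD _ _))// lerD.
Qed.

Theorem theorem5p1 (R : realType) (U : metricType R)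
    (E : completeNormedModType R) :
  urysohn_space U -> superreflexive E ->
  ~ (exists f : U -> E, uniform_embedding f).
Proof.
move=> [_ _ Uuniv _] superE [f /uniform_embedding_moduli[fcont finv]].
have [j jiso] := Uuniv (c00 R) c00_separable.
have [xi [xiU xi_free]] := ultraFilterLemma eventually_filter.
have [i iiso] := ultrapower_diagonal E xiU.
pose G (P : c00 R) : ultrapower E xiU := i (f (j P)).
have [d d0 dP] : exists2 d : R, 0 < d &
    forall P Q, `|G P - G Q| < d -> mdist P Q < 1.
  have [d d0 dP] := finv _ ltr01.
  by exists d => // P Q; rewrite iiso => /dP; rewrite jiso.
have e0 : 0 < d / 4 by rewrite divr_gt0.
have [c c0 cP] : exists2 c : R, 0 < c &
    forall P Q, mdist P Q < c -> `|G P - G Q| < d / 4.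
  have [c c0 cP] := fcont _ e0.
  by exists c => // P Q; rewrite -jiso iiso => /cP.
have [M GM] := unif_continuous_bounded_on_c00_ball c0 (fun P Q PQ => ltW (cP P Q PQ)).
have [k _ /= /(_ _ (leqnn k)) kc] := near_infty_natSinv_lt (PosNum c0).
have [x xP] := interlacing_center xiU xi_free (superE _ _ xiU)
  (fun p (pk : size p = k.+1) => GM _ (supnorm_staircase pk)).
(* Interlaced tuples are moved by less than d / 4, and the error allowed is
   d / 4 too, so that two points near x are less than d apart. *)
have {}xP N : exists m, [/\ size m = k.+1, all (ltn N) m &
    `|G (staircase k.+1 m) - x| < d / 2].
  have [m [n [mk nk Nm mn mx]]] := xP N _ e0; exists m; split=> //.
  have := cP _ _ (le_lt_trans (c00_mdist_le (staircase_interlaced k.+1 mn)) kc).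
  by move: mx; lra.
have [m [mk _ mx]] := xP 0%N.
(* The second tuple lies beyond the first. *)
have [n [nk bn nx]] := xP (\max_(l <- m) l)%N.
have mb : all (geq (\max_(l <- m) l)%N) m.
  by apply/allP => l lm /=; exact: leq_bigmax_seq.
have /dP : `|G (staircase k.+1 m) - G (staircase k.+1 n)| < d.
  rewrite -(subrKA x) (le_lt_trans (ler_normD _ _))// [ltRHS]splitr ltrD//.
  by rewrite distrC.
apply/negP; rewrite -leNgt c00_mdistE -[leLHS](rmorph1 (ratr : rat -> R)) ler_rat.
exact: staircase_separated nk mb bn.
Qed.
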